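(* Let $\mathcal G=(V,E)$ be a locally finite simple undirected graph and let $A\subset V$ be a proper nonempty subset. The following are equivalent: (1) $A$ is area-minimizing (a minimal subgraph) in $V$; (2) for every finite $U\subset V$, the function $1_{A\cap\overline U}\in\mathbb R^{\overline U}$ is of least gradient in $U$; (3) $0\in\Delta_1^V(1_A)$, i.e. there is a function $a$ on ordered pairs $(x,y)$ with $\{x,y\}\in E$ such that $a_{xy}=-a_{yx}$, $a_{xy}\in\mathrm{Sgn}(1_A(x)-1_A(y))$ for every edge, and $\sum_{y\sim x}a_{xy}=0$ for every $x\in V$.
   Context: For $\Omega\subset V$: $\tau\Omega=\{z\in V\setminus\Omega:\exists w\in\Omega,\ z\sim w\}$, $\overline\Omega=\Omega\cup\tau\Omega$, $E_\Omega=\{\{x,y\}\in E:x\in\Omega,y\in\overline\Omega\}$, and $\partial\Omega=\{\{x,y\}\in E:x\in\Omega,y\notin\Omega\}$. For finite $U\subset V$, a set $K\subset\overline U$ is of least perimeter in $U$ if for every $\hat K\subset\overline U$ with $\hat K\cap\tau U=K\cap\tau U$ one has $|\partial K\cap E_U|\le|\partial\hat K\cap E_U|$. A proper nonempty $A\subset V$ is area-minimizing (called a minimal subgraph) if $A\cap\overline U$ is of least perimeter in $U$ for every finite $U\subset V$. For finite $U$ and $f\in\mathbb R^{\overline U}$, $J_U(f)=\frac12\sum_{\{x,y\}\in E_U}|f(y)-f(x)|$ (each edge counted with both orientations); $f$ is of least gradient in $U$ if $J_U(g)\ge J_U(f)$ for all $g\in\mathbb R^{\overline U}$ with $g|_{\tau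 U}=f|_{\tau U}$. $\mathrm{Sgn}(t)=\{1\}$ if $t>0$, $[-1,1]$ if $t=0$, $\{-1\}$ if $t<0$. $\Delta_1^V f$ is the set of functions $x\mapsto\sum_{y\sim x}a_{xy}$ over all antisymmetric $a$ on edges with $a_{xy}\in\mathrm{Sgn}(f(x)-f(y))$. *)

(* Defs.v *)
From mathcomp Require Import all_boot all_order all_algebra.
From mathcomp Require Import all_classical all_reals all_analysis.

Set Implicit Arguments.
Unset Strict Implicit.
Unset Printing Implicit Defensive.

Import Order.TTheory GRing.Theory Num.Theory.

Local Open Scope classical_set_scope.
Local Open Scope ring_scope.

Section Graph.
Variables (V : choiceType) (adj : rel V).
Implicit Types (U K A Omega : set V).

Definition nbrs (x : V) : set V := [set y | adj x y].

Definition locally_finite : Prop := forall x, finite_set (nbrs x).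

Definition vertex_boundary Omega : set V :=
  [set z | ~ Omega z /\ exists2 w, Omega w & adj z w].

Definition vertex_closure Omega : set V := Omega `|` vertex_boundary Omega.

(* The unordered edge {x, y} is encoded as the subset [set x; y] of V. *)
Definition edges : set (set V) :=
  [set e | exists x y, adj x y /\ e = [set x; y]].

Definition edges_in Omega : set (set V) :=
  [set e | edges e /\
     exists x y, [/\ Omega x, vertex_closure Omega y & e = [set x; y]]].

Definition edge_boundary Omega : set (set V) :=
  [set e | edges e /\
     exists x y, [/\ Omega x, ~ Omega y & e = [set x; y]]].

(* In a locally finite graph [edges_in U] is finite for finite U, so that #<=
   below compares two finite cardinals. *)
Definition least_perimeter U K : Prop :=
  K `<=` vertex_closure U /\
  forall K', K' `<=` vertex_closure U ->
    K' `&` vertex_boundary U = K `&` vertex_boundary U ->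
    (edge_boundary K `&` edges_in U #<= edge_boundary K' `&` edges_in U)%card.

Definition area_minimizing A : Prop :=
  forall U, finite_set U -> least_perimeter U (A `&` vertex_closure U).

Variable R : realType.

(* A function on [vertex_closure U] is represented by a function on V, whose
   values outside [vertex_closure U] are irrelevant to [edge_variation U] and
   to [least_gradient U]. The sum ranges over ordered pairs, so that each edge
   is counted with both orientations. *)
Definition edge_variation U (f : V -> R) : R :=
  2^-1 * \sum_(p \in [set p : V * V | edges_in U [set p.1; p.2]])
            `|f p.2 - f p.1|.

Definition least_gradient U (f : V -> R) : Prop :=
  forall g : V -> R, (forall x, vertex_boundary U x -> g x = f x) ->
    edge_variation U f <= edge_variation U g.

Definition Sgn (t : R) : set R :=
  if 0 < t then [set 1] else if t == 0 then `[-1, 1]%classic else [set -1].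

(* Only the values of [a] at adjacent pairs matter. *)
Definition one_laplacian (f : V -> R) : set (V -> R) :=
  [set h | exists a : V -> V -> R,
     [/\ forall x y, adj x y -> a x y = - a y x,
         forall x y, adj x y -> Sgn (f x - f y) (a x y) &
         h = fun x => \sum_(y \in nbrs x) a x y]].

End Graph.

(* Main.v *)
Require Import Defs.
From mathcomp Require Import all_boot all_order all_algebra.
From mathcomp Require Import finmap.
From mathcomp Require Import all_classical all_reals all_analysis.
From mathcomp Require Import lra zify.

(* A solution [a] of [0 \in one_laplacian 1_A] is a calibration: by the discrete
   Green formula it forces 1_A to minimize the variation on every finite U.
   Testing with indicator functions then gives the minimality of the perimeter.

   Conversely, on a finite U a calibration is an integral flow with prescribed
   value 1 on the edges from A to its complement, and it exists by the max-flow
   min-cut argument: choose a {-1, 0, 1}-valued antisymmetric [a] minimizing the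
   total |divergence| in U. If the divergence is nonzero somewhere, either an
   augmenting path decreases the total, or the vertices reachable in the residual
   graph form a set S such that A \ S (or A \cup S) has smaller perimeter. An
   ultrafilter on the finite subsets of V yields a global calibration. *)

Set Implicit Arguments.
Unset Strict Implicit.
Unset Printing Implicit Defensive.

Import Order.TTheory GRing.Theory Num.Theory.

Local Open Scope classical_set_scope.
Local Open Scope ring_scope.

(** * Cuts and flows on a finite list of vertices *)

Section FiniteNetwork.
Variables (V : eqType) (adj : rel V) (adj_sym : symmetric adj).
Variables (W : seq V) (u : pred V) (uniqW : uniq W).

Definition inner_edge (x y : V) := adj x y && (u x || u y).

Definition divergence (Z : zmodType) (a : V -> V -> Z) (x : V) : Z :=
  \sum_(y <- W | adj x y) a x y.

(** A boundary edge contributes only in its orientation out of [K], hence once. *)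
Definition perimeter (K : pred V) : nat :=
  \sum_(x <- W) \sum_(y <- W | inner_edge x y) (K x && ~~ K y).

Lemma inner_edge_sym : symmetric inner_edge.
Proof. by move=> x y; rewrite /inner_edge adj_sym orbC. Qed.

Lemma perimeterC (K : pred V) : perimeter (predC K) = perimeter K.
Proof.
rewrite /perimeter (exchange_big_dep xpredT) //=; apply: eq_bigr => x _.
under eq_bigl => y do rewrite inner_edge_sym.
by apply: eq_bigr => y _; rewrite negbK andbC.
Qed.

Lemma eq_perimeter (K K' : pred V) :
  {in W, K =1 K'} -> perimeter K = perimeter K'.
Proof.
move=> KK'; rewrite /perimeter big_seq [RHS]big_seq; apply: eq_bigr => x xW.
rewrite big_seq_cond [RHS]big_seq_cond; apply: eq_bigr => y /andP[yW _].
by rewrite !KK'.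
Qed.

(** * Summation by parts *)

Section Flux.
Variables (R : comNzRingType) (a : V -> V -> R).
Hypothesis a_anti : forall x y, adj x y -> a x y = - a y x.

(** Discrete Green formula: by antisymmetry both halves of the difference give the same sum. As [h]
    vanishes off [u], only vertices of [u] remain, and every edge at such a vertex is an inner
    edge. *)
Lemma flux (h : V -> R) : {in W, forall x, ~~ u x -> h x = 0} ->
  \sum_(x <- W) \sum_(y <- W | inner_edge x y) a x y * (h x - h y) =
  (\sum_(x <- W | u x) h x * divergence a x) *+ 2.
Proof.
move=> h0.
have sum_inner : \sum_(x <- W) \sum_(y <- W | inner_edge x y) a x y * h x =
    \sum_(x <- W | u x) h x * divergence a x.
  rewrite [RHS]big_mkcond; apply: eq_big_seq => x xW /=.
  case: ifPn => ux; last by rewrite h0// big1 // => y _; rewrite mulr0.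
  rewrite mulr_sumr; apply: eq_big => [y|y _]; last by rewrite mulrC.
  by rewrite /inner_edge ux andbT.
rewrite mulr2n -{1}sum_inner -sum_inner.
rewrite [X in _ + X](exchange_big_dep xpredT) //= -big_split /=.
apply: eq_bigr => x _.
under [X in _ + X]eq_bigl => y do rewrite inner_edge_sym.
rewrite -big_split /=; apply: eq_bigr => y /andP[xy _].
by rewrite (a_anti xy) mulrBr !mulNr opprK addrC.
Qed.

Lemma flux_indicator (K : pred V) :
    (forall x y, inner_edge x y -> K x -> ~~ K y -> a x y = 1) ->
  \sum_(x <- W) \sum_(y <- W | inner_edge x y) a x y * ((K x)%:R - (K y)%:R) =
  (perimeter K)%:R *+ 2.
Proof.
(* One copy of the perimeter counts the pairs leaving [K]; the other, through the complement, counts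
   those entering it. *)
move=> aK; rewrite mulr2n -{1}perimeterC /perimeter !natr_sum -big_split.
apply: eq_bigr => x _ /=; rewrite !natr_sum -big_split.
apply: eq_bigr => y xy /=; case: (boolP (K x)) (boolP (K y)) => Kx [] Ky /=;
  rewrite ?subrr ?mulr0 ?addr0 //.
  by rewrite aK// subr0 mulr1 add0r.
rewrite a_anti ?aK//; first by rewrite mulN1r opprB subr0.
  by rewrite inner_edge_sym.
by case/andP: xy.
Qed.

End Flux.

(** * Max-flow min-cut by augmenting paths *)

Section Flow.
Implicit Types (A B : pred V) (a : V -> V -> int).
Hypothesis sub_uW : {subset u <= W}.
Hypothesis nbrs_uW : forall x y, u x -> adj x y -> y \in W.

(** Antisymmetry turns the upper bound into [-1 <= a x y] as well, so integrality leaves only the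
    values -1, 0 and 1 on edges. *)
Definition calibrating A a := [/\ forall x y, adj x y -> a x y = - a y x,
  forall x y, adj x y -> a x y <= 1 &
  forall x y, adj x y -> A x -> ~~ A y -> a x y = 1].

(* The edges along which [a], being {-1, 0, 1}-valued, can be lowered by one
   without leaving the calibrating functions of [A]. *)
Definition residual A a : rel V :=
  fun x y => [&& u x, adj x y, 0 <= a x y & ~~ (A x && ~~ A y)].

Definition push a x y : V -> V -> int := fun v w =>
  a v w - ((v == x) && (w == y))%:R + ((v == y) && (w == x))%:R.

Lemma calibratingC A a :
  calibrating A a -> calibrating (predC A) (fun x y => - a x y).
Proof.
case=> a_anti a_le1 a1; split=> x y xy.
- by rewrite a_anti.
- have yx : adj y x by rewrite adj_sym.
  by rewrite -a_anti// a_le1.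
- move=> /= Ax /negPn Ay; have yx : adj y x by rewrite adj_sym.
  by rewrite -a_anti// a1.
Qed.

(** The reverse value [a y x] is at most 0, so it can be raised by one; for the same reason the
    reverse pair is not one forced to be 1. *)
Lemma calibrating_push A a x y : x != y -> adj x y -> 0 <= a x y -> 
    ~~ (A x && ~~ A y) -> calibrating A a -> calibrating A (push a x y).
Proof.
move=> Nxy xy axy NAxy [a_anti a_le1 a1]; rewrite /push.
have ayx : a y x <= 0 by rewrite a_anti 1?adj_sym// oppr_le0.
have NAyx : ~~ (A y && ~~ A x).
  apply/negP => /andP[Ay NAx]; have := a1 y x.
  by rewrite adj_sym xy Ay NAx => /(_ isT isT isT) a_yx; rewrite a_yx in ayx.
split=> v w vw.
- rewrite (a_anti _ _ vw) (andbC (w == x)) (andbC (w == y)).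
  by case: (_ && _); case: (_ && _) => /=; lia.
- have := a_le1 _ _ vw.
  case: (boolP ((v == y) && _)) => [/andP[/eqP-> /eqP->]|_].
    by rewrite eq_sym (negPf Nxy) /=; lia.
  by case: (_ && _) => /=; lia.
- move=> Av NAw; have := a1 _ _ vw Av NAw.
  case: (boolP ((v == y) && _)) => [/andP[/eqP vy /eqP wx]|_].
    by rewrite -vy -wx Av NAw in NAyx.
  case: (boolP ((v == x) && _)) => [/andP[/eqP vx /eqP wy]|_].
    by rewrite -vx -wy Av NAw in NAxy.
  by rewrite subr0 addr0.
Qed.

Lemma divergence_push a x y v : adj x y -> x \in W -> y \in W ->
  divergence (push a x y) v = divergence a v - (v == x)%:R + (v == y)%:R.
Proof.
move=> xy xW yW; rewrite /divergence /push big_split sumrB /=.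
have sum1 (s t : V) : adj s t -> t \in W ->
    \sum_(w <- W | adj v w) ((v == s) && (w == t))%:R = (v == s)%:R :> int.
  move=> st tW; have [->|_] := eqVneq v s; last by rewrite big1.
  rewrite (big_rem t)//= st eqxx big1_seq ?addr0// => w /andP[_].
  by case: eqVneq => // ->; rewrite mem_rem_uniqF.
rewrite !sum1 // adj_sym //.
Qed.

(** Pushing along each edge of the path telescopes the divergence changes. The last clause serves
    the induction: pushing along the tail leaves [a x y] intact, so the first edge is still
    residual. *)
Lemma augment A a x p : calibrating A a -> path (residual A a) x p ->
    uniq (x :: p) ->
  exists a', [/\ calibrating A a',
    forall v, u v ->
      divergence a' v = divergence a v - (v == x)%:R + (v == last x p)%:R &
    forall v w, v \notin x :: p -> a' v w = a v w].
Proof.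
move=> cal; elim: p x => [|y p IH] x.
  by exists a; split=> // v _ /=; rewrite addrNK.
rewrite [path _ _ _]/= => /andP[/and4P[ux xy axy NAxy] yp].
rewrite cons_uniq => /andP[xyp yp_uniq].
have [a' [cal' div' a'E]] := IH y yp yp_uniq.
exists (push a' x y); split.
- apply: calibrating_push => //; last by rewrite a'E.
  by move: xyp; rewrite in_cons negb_or => /andP[].
- move=> v uv; rewrite divergence_push//; last 2 first.
    exact: sub_uW.
    exact: nbrs_uW xy.
  by rewrite div'//= ; lia.
- move=> v w; rewrite in_cons negb_or => /andP[Nvx Nvyp].
  rewrite /push (negPf Nvx) /= a'E//.
  move: Nvyp; rewrite in_cons negb_or => /andP[/negPf-> _] /=.
  by rewrite subr0 addr0.
Qed.

(** Vertices of [W] off [u] are not counted: they act as free sources and sinks. *)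
Definition excess a : nat := \sum_(x <- W | u x) `|divergence a x|%N.

(** The unit moved to [z] lowers the positive divergence of [x]; at [z] it is either not counted or
    offsets a negative divergence. *)
Lemma excess_decr a a' x z : u x -> 0 < divergence a x ->
    z != x -> (u z -> divergence a z < 0) ->
    (forall v, u v ->
      divergence a' v = divergence a v - (v == x)%:R + (v == z)%:R) ->
  (excess a' < excess a)%N.
Proof.
move=> ux ax zx az div'.
have a'le v : u v -> (`|divergence a' v| + (v == x) <= `|divergence a v|)%N.
  move=> uv; rewrite div'//; have [->|vx] := eqVneq v x.
    by rewrite (eq_sym x) (negPf zx) /=; lia.
  case: eqVneq => [vz|_] /=; last by lia.
  by subst v; have := az uv; lia.
have xW : x \in W by exact: sub_uW.
rewrite /excess !(big_rem x xW) /= ux -addSn leq_add//.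
  by have := a'le x ux; rewrite eqxx addn1.
by apply: leq_sum => v uv; apply: leq_trans (a'le v uv); rewrite leq_addr.
Qed.

Definition perimeter_minimizing A := forall B,
  {in W, forall x, ~~ u x -> A x = B x} -> (perimeter A <= perimeter B)%N.

Lemma perimeter_minimizingC A :
  perimeter_minimizing A -> perimeter_minimizing (predC A).
Proof.
move=> Amin B AB; rewrite perimeterC -(perimeterC B).
by apply: Amin => x xW ux /=; rewrite -AB//= negbK.
Qed.

(* The vertices reachable from an excess vertex in the residual graph either
   contain the end of an augmenting path or bound a cut contradicting the
   minimality of [A]. *)
Lemma improve_pos A a x : perimeter_minimizing A -> calibrating A a ->
    u x -> 0 < divergence a x ->
  exists2 a', calibrating A a' & (excess a' < excess a)%N.
Proof.
move=> Amin cal ux ax.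
pose reach y := `[< exists2 p, path (residual A a) x p & y = last x p >].
have reach_x : reach x by apply/asboolP; exists [::].
have reach_step y z : reach y -> residual A a y z -> reach z.
  move=> /asboolP[p xp ->] yz; apply/asboolP; exists (rcons p z).
    by rewrite rcons_path xp.
  by rewrite last_rcons.
(* Such a [z] can absorb one unit: it lies off [u] or has negative divergence. *)
have [[z [rz zx az]]|Nz] := pselect (exists z, [/\ reach z, z != x &
    (u z -> divergence a z < 0)]).
  move: rz => /asboolP[p /shortenP[p' xp' p'_uniq _] zE].
  have [a' [cal' div' _]] := augment cal xp' p'_uniq.
  by exists a' => //; apply: excess_decr ux ax zx az _; rewrite zE.
have reach_u y : reach y -> u y && (0 <= divergence a y).
  move=> ry; have [->|yx] := eqVneq y x; first by rewrite ux ltW.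
  apply/negPn/negP => Ny; apply: Nz; exists y; split=> // uy.
  by move: Ny; rewrite uy /= -ltNge.
(* Residual edges never cross between [A] and its complement: one direction is excluded by
   definition, the other carries -1. *)
have reachA y : reach y -> A y = A x.
  move=> /asboolP[p xp ->]; elim/last_ind: p xp => [//|p z IH].
  rewrite rcons_path last_rcons => /andP[/IH <- /and4P[_ yz ayz]].
  case: cal => a_anti _ a1.
  case: (boolP (A (last x p))) (boolP (A z)) => Ay [] Az //= _.
  have zy : adj z (last x p) by rewrite adj_sym.
  by move: ayz; rewrite a_anti// a1// oppr_ge0 ler10.
have cut y z : reach y -> ~~ reach z -> adj y z -> ~~ (A y && ~~ A z) ->
    a y z = -1.
  move=> ry Nrz yz NA.
  have : ~~ (0 <= a y z).
    apply: contra Nrz => ayz; apply: (reach_step y) => //.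
    by rewrite /residual yz ayz NA; case/andP: (reach_u _ ry) => ->.
  have zy : adj z y by rewrite adj_sym.
  case: cal => a_anti /(_ z y zy) a_le1 _; rewrite (a_anti y z)//; lia.
have a_anti : forall v w, adj v w -> a v w = - a w v by case: cal.
have reach0 : {in W, forall v, ~~ u v -> (reach v)%:R = 0 :> int}.
  by move=> v _; case: (boolP (reach v)) => // /reach_u/andP[->].
have pos : 0 < \sum_(v <- W | u v) (reach v)%:R * divergence a v.
  rewrite (big_rem x) ?ux ?sub_uW//= reach_x mul1r ltr_wpDr//.
  apply: sumr_ge0 => v _; case: (boolP (reach v)) => [/reach_u/andP[_]|_].
    by rewrite mul1r.
  by rewrite mul0r.
(* By the Green formula, twice this positive sum is the flux out of the reached set, which is now
   shown to be nonpositive. *)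
exfalso; move: pos; rewrite ltNge => /negP; apply.
rewrite -(pmulrn_lle0 _ (ltn0Sn 1)) -flux//.
(* If [x] is outside [A], no edge leaving the reached set is forced to be 1, so all carry -1 and the
   flux is minus twice a perimeter. *)
case: (boolP (A x)) => Ax; last first.
  suff -> : \sum_(v <- W) \sum_(w <- W | inner_edge v w)
      a v w * ((reach v)%:R - (reach w)%:R) = - ((perimeter reach)%:R *+ 2).
    by rewrite oppr_le0 mulrn_wge0.
  rewrite -(@flux_indicator _ (fun v w => - a v w)).
  - rewrite -sumrN; apply: eq_bigr => v _; rewrite -sumrN.
    by apply: eq_bigr => w _; rewrite mulNr opprK.
  - by move=> v w vw; rewrite a_anti.
  - move=> v w /andP[vw _] rv Nrw; rewrite (cut v w)//.
    by rewrite (reachA v rv) (negPf Ax).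
(* The reached set now lies in [A], so its indicator is that of [A] minus that of [B]. As [a] is 1
   on the edges leaving [A] and on those leaving [B], the flux is twice the difference of their
   perimeters. *)
pose B := [pred v | A v && ~~ reach v].
have -> : \sum_(v <- W) \sum_(w <- W | inner_edge v w)
    a v w * ((reach v)%:R - (reach w)%:R) =
    (perimeter A)%:R *+ 2 - (perimeter B)%:R *+ 2.
  rewrite -!(@flux_indicator _ a)//; first 1 last.
  - move=> v w /andP[vw _] /andP[Av Nrv] NBw.
    have [rw|Nrw] := boolP (reach w).
      rewrite a_anti// (cut w v)// 1?adj_sym//.
      by rewrite negb_and Av orbT.
    case: cal => _ _ -> //.
    by move: NBw; rewrite /= Nrw andbT.
  - by move=> v w /andP[vw _] Av NAw; case: cal => _ _ ->.
  rewrite -sumrB; apply: eq_bigr => v _; rewrite -sumrB.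
  apply: eq_bigr => w _; rewrite -mulrBr.
  have BE (t : V) : (B t)%:R = (A t)%:R - (reach t)%:R :> int.
    rewrite /=; have [rt|_] := boolP (reach t); last by rewrite andbT subr0.
    by rewrite (reachA t rt) Ax subrr.
  by rewrite !BE; congr (_ * _); lia.
rewrite subr_le0 lerMn2r /= ler_nat; apply: Amin => v _ Nuv.
rewrite /=; case: (boolP (reach v)) => [/reach_u/andP[uv]|_]; last by rewrite andbT.
by rewrite uv in Nuv.
Qed.

(** A negative divergence becomes positive on replacing [a] by its opposite and [A] by its
    complement. *)
Lemma improve A a x : perimeter_minimizing A -> calibrating A a ->
    u x -> divergence a x != 0 ->
  exists2 a', calibrating A a' & (excess a' < excess a)%N.
Proof.
move=> Amin cal ux; have divN b v :
    divergence (fun x y => - b x y) v = - divergence b v :> int.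
  by rewrite /divergence sumrN.
have excessN b : excess (fun x y => - b x y) = excess b.
  by apply: eq_bigr => v _; rewrite divN abszN.
rewrite neq_lt => /orP[ax|]; last exact: improve_pos.
have [|a' cal' lt_a'] :=
  improve_pos (perimeter_minimizingC Amin) (calibratingC cal) ux.
  by rewrite divN oppr_gt0.
exists (fun x y => - a' x y); last by rewrite excessN -(excessN a).
have := calibratingC cal'; case=> anti le1 eq1; split=> // v w vw Av NAw.
by apply: eq1 => //=; rewrite negbK.
Qed.

Lemma divergence_free_calibration A : perimeter_minimizing A ->
  exists2 a, calibrating A a & forall x, u x -> divergence a x = 0.
Proof.
(* The descent on [excess] starts from the gradient of the indicator of [A]. *)
move=> Amin; pose a0 (x y : V) : int := (A x)%:R - (A y)%:R.
have cal0 : calibrating A a0.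
  split=> [x y _|x y _|x y _ Ax NAy]; rewrite /a0; first by rewrite opprB.
    by case: (A x); case: (A y).
  by rewrite Ax (negPf NAy).
have [n] := ubnP (excess a0); elim: n a0 cal0 => // n IH a cal ltn.
have [[x [ux ax]]|Nx] := pselect (exists x, u x /\ divergence a x != 0).
  have [a' cal' lt'] := improve Amin cal ux ax.
  by apply: IH cal' _; exact: leq_trans lt' _.
exists a => // x ux; apply/eqP/negPn/negP => ax.
by apply: Nx; exists x.
Qed.

End Flow.
End FiniteNetwork.

Lemma card_uniq_seq (T : choiceType) (s : seq T) :
  uniq s -> ([set` s] #= `I_(size s))%card.
Proof.
move=> s_uniq; have -> : [set` s] = [set` [fset x in s]%fset].
  by apply/seteqP; split=> x /=; rewrite inE.
by apply/card_eq_fsetP; rewrite [LHS]card_fseq undup_id.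
Qed.

Lemma Sgn_norm (R : realType) (t s : R) : Sgn t s -> `|s| <= 1.
Proof.
rewrite /Sgn; case: ltP => _; first by move=> /= ->; rewrite normr1.
case: eqP => _ /=; first by rewrite in_itv /= ler_norml.
by move=> ->; rewrite normrN1.
Qed.

(** * From finite lists to the locally finite graph *)

Section LocallyFiniteGraph.
Variables (V : choiceType) (adj : rel V).
Hypotheses (adj_sym : symmetric adj) (adj_irr : irreflexive adj).
Hypothesis adj_lf : locally_finite adj.
Implicit Types (A K U : set V).

(** Meaningful for finite closures only: [fset_set] is empty on an infinite set. *)
Definition closure_seq U : seq V :=
  enum_fset (fset_set (vertex_closure adj U)).

Lemma finite_vertex_closure U :
  finite_set U -> finite_set (vertex_closure adj U).
Proof.
move=> finU; rewrite finite_setU; split=> //.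
apply: (@sub_finite_set _ _ (\bigcup_(x in U) nbrs adj x)).
  by move=> z [_ [w Uw zw]]; exists w => //; rewrite /nbrs /= adj_sym.
by apply: bigcup_finite => // x _; exact: adj_lf.
Qed.

Lemma closure_seq_uniq U : uniq (closure_seq U).
Proof. exact: fset_uniq. Qed.

Section FiniteDomain.
Variables (U : set V) (finU : finite_set U).
Let W := closure_seq U.
Let u : pred V := mem U.

Lemma mem_closure_seq x : (x \in W) = (x \in vertex_closure adj U).
Proof.
have := in_fset_set (finite_vertex_closure finU) x.
by [].
Qed.

Lemma closure_seqP x : reflect (vertex_closure adj U x) (x \in W).
Proof. by rewrite mem_closure_seq; apply: (iffP idP); rewrite inE. Qed.

Lemma sub_closure_seq : {subset u <= W}.
Proof. by move=> x /set_mem Ux; apply/closure_seqP; left. Qed.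

Lemma nbrs_closure_seq x y : u x -> adj x y -> y \in W.
Proof.
move=> /set_mem Ux xy; apply/closure_seqP; have [Uy|NUy] := pselect (U y).
  by left.
by right; split=> //; exists x; rewrite // adj_sym.
Qed.

Lemma edges_in_pair x y :
  edges_in adj U [set x; y] <-> [/\ x \in W, y \in W & inner_edge adj u x y].
Proof.
rewrite /inner_edge; split; last first.
  move=> [/closure_seqP xW /closure_seqP yW /andP[xy /orP[]/set_mem Uxy]];
    (split; first by exists x, y); first by exists x, y.
  by exists y, x; split=> //; rewrite setUC.
move=> [[x' [y' [xy' e]]] [x0 [y0 [Ux0 Cy0 e0]]]].
have xy : adj x y.
  (* Without loops [x'] and [y'] differ, so they are [x] and [y] in some order. *)
  have Nloop z : x' = z -> y' = z -> False.
    by move=> x'z y'z; rewrite x'z y'z adj_irr in xy'.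
  have : [set x; y] y' by rewrite e; right.
  have : [set x; y] x' by rewrite e; left.
  case=> /= x'E [] /= y'E; first by case: (Nloop x).
  - by rewrite -x'E -y'E.
  - by rewrite -x'E -y'E adj_sym.
  - by case: (Nloop y).
have : [set x; y] x0 by rewrite e0; left.
have ux0 : u x0 by exact/mem_set.
case=> /= ?; subst x0; split=> //.
- exact: sub_closure_seq.
- exact: nbrs_closure_seq xy.
- by rewrite xy ux0.
- by apply: (nbrs_closure_seq ux0); rewrite adj_sym.
- exact: sub_closure_seq.
- by rewrite xy ux0 orbT.
Qed.

Lemma edges_in_pairs : [set p : V * V | edges_in adj U [set p.1; p.2]] =
  [set` [seq p <- [seq (x, y) | x <- W, y <- W] | inner_edge adj u p.1 p.2]].
Proof.
apply/seteqP; split=> -[x y] /=.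
  move=> /edges_in_pair[xW yW xy]; rewrite mem_filter /= xy.
  by apply/allpairsP; exists (x, y).
rewrite mem_filter /= => /andP[xy /allpairsP[[x' y'] /= [xW yW [? ?]]]].
by subst x' y'; apply/edges_in_pair.
Qed.

Lemma pairs_uniq : uniq [seq (x, y) | x <- W, y <- W].
Proof. by apply: allpairs_uniq; [exact: fset_uniq..|move=> [? ?] [? ?]]. Qed.

Lemma edge_variationE (R : realType) (f : V -> R) : edge_variation adj U f =
  2^-1 * \sum_(x <- W) \sum_(y <- W | inner_edge adj u x y) `|f y - f x|.
Proof.
rewrite /edge_variation edges_in_pairs -fsbig_seq ?filter_uniq ?pairs_uniq//.
rewrite big_filter big_mkcond big_allpairs_dep; congr (_ * _).
by apply: eq_bigr => x _; rewrite -big_mkcond.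
Qed.

(** The gradient of the indicator of [K] calibrates [K], and its square equals its absolute value;
    the factor one half undoes the double orientation. *)
Lemma edge_variation_indic (R : realType) K :
  edge_variation adj U (\1_K : V -> R) = (perimeter adj W u (mem K))%:R.
Proof.
rewrite edge_variationE -[RHS](mulKf (x := 2)) ?pnatr_eq0// mulr_natl.
have -> : (perimeter adj W u (mem K))%:R *+ 2 =
    \sum_(x <- W) \sum_(y <- W | inner_edge adj u x y)
      ((x \in K)%:R - (y \in K)%:R) * ((x \in K)%:R - (y \in K)%:R) :> R.
  rewrite (@flux_indicator V adj adj_sym W u R
    (fun x y => (x \in K)%:R - (y \in K)%:R))//.
    by move=> x y _; rewrite opprB.
  by move=> x y _ xK yK; rewrite /= in xK yK *; rewrite xK (negPf yK) subr0.
congr (_ * _); apply: eq_bigr => x _; apply: eq_bigr => y _.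
rewrite !indicE; case: (x \in K); case: (y \in K);
  by rewrite ?subrr ?subr0 ?sub0r ?normrN ?normr1 ?normr0 ?mulrNN ?mulr0 ?mulr1.
Qed.

Lemma card_edge_boundary K : (edge_boundary adj K `&` edges_in adj U #=
  `I_(perimeter adj W u (mem K)))%card.
Proof.
pose L := [seq p <- [seq (x, y) | x <- W, y <- W] |
  inner_edge adj u p.1 p.2 && ((p.1 \in K) && (p.2 \notin K))].
have -> : edge_boundary adj K `&` edges_in adj U =
    (fun p : V * V => [set p.1; p.2]) @` [set` L].
  apply/seteqP; split=> [e [[_ [x [y [Kx NKy ->]]]]] /edges_in_pair[xW yW xy]|].
    exists (x, y) => //=; rewrite mem_filter /= xy mem_set// memNset//=.
    by apply/allpairsP; exists (x, y).
  move=> e [[x y] /=]; rewrite mem_filter /= => /andP[/and3P[xy xK yK] xyW] <-.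
  have xyU : edges_in adj U [set x; y].
    apply/edges_in_pair.
    by case/allpairsP: xyW => -[x' y'] /= [? ? [? ?]]; subst x' y'.
  split=> //; split; first by case: xyU.
  exists x, y; split=> //; first exact/set_mem.
  by move=> /mem_set; rewrite (negPf yK).
(* The orientation can be read off the unordered edge, since exactly one endpoint is in [K]. *)
have inj : {in [set` L] &, injective (fun p : V * V => [set p.1; p.2])}.
  move=> [x y] [x' y']; rewrite !inE /= !mem_filter /=.
  move=> /andP[/and3P[_ xK yK] _] /andP[/and3P[_ x'K y'K] _] e.
  have : [set x'; y'] x by rewrite -e; left.
  have : [set x'; y'] y by rewrite -e; right.
  case=> [yx'|->]; first by rewrite yx' x'K in yK.
  by case=> [->//|xy']; rewrite xy' (negPf y'K) in xK.
rewrite (card_eql (inj_card_eq inj)).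
have -> : perimeter adj W u (mem K) = size L.
  rewrite size_filter -sum1_count [RHS]big_mkcond big_allpairs_dep.
  apply: eq_bigr => x _; rewrite [LHS]big_mkcond; apply: eq_bigr => y _ /=.
  by case: inner_edge => //=; case: (_ && _).
by rewrite card_uniq_seq// filter_uniq// pairs_uniq.
Qed.

Lemma vertex_boundaryP x : vertex_boundary adj U x <-> x \in W /\ ~~ u x.
Proof.
split=> [[NUx xU]|[/closure_seqP[] // Ux /negP]].
  by split; [apply/closure_seqP; right; split|apply/negP => /set_mem].
by case; exact/mem_set.
Qed.

(** [perimeter] sees only vertices of [W], so intersecting with the closure changes nothing, and
    cardinals compare as natural numbers. *)
Lemma least_perimeterP A :
  least_perimeter adj U (A `&` vertex_closure adj U) <->
  perimeter_minimizing adj W u (mem A).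
Proof.
have memW K : {in W, mem (K `&` vertex_closure adj U) =1 mem K}.
  by move=> x; rewrite mem_closure_seq /= in_setI => ->; rewrite andbT.
have card_le K K' : (edge_boundary adj K `&` edges_in adj U #<=
    edge_boundary adj K' `&` edges_in adj U)%card =
    (perimeter adj W u (mem K) <= perimeter adj W u (mem K'))%N.
  rewrite (card_le_eql (card_edge_boundary K)).
  by rewrite (card_le_eqr (card_edge_boundary K')) card_le_II.
split=> [[_ min] B AB|min].
  have := min ([set` B] `&` vertex_closure adj U).
  rewrite card_le !(eq_perimeter _ _ (memW _)).
  have -> : perimeter adj W u (mem [set` B]) = perimeter adj W u B.
    by apply: eq_perimeter => x _; rewrite /= mem_setE.
  apply; first exact: subIsetr.
  apply/seteqP; split=> x [[Kx xU] xbd]; do ![split=> //];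
    have /vertex_boundaryP[xW Nux] := xbd; have /= AB_x := AB x xW Nux.
    by apply/set_mem; rewrite AB_x.
  by rewrite /= unfold_in -AB_x mem_set.
split; first exact: subIsetr.
move=> K' K'U K'A; rewrite card_le (eq_perimeter _ _ (memW A)); apply: min.
move=> x xW Nux; have bdx : vertex_boundary adj U x by apply/vertex_boundaryP.
have xU : vertex_closure adj U x by right.
move/seteqP: K'A => [K'A AK']; apply/idP/idP => /set_mem xK; apply/mem_set.
  by have [] : (K' `&` vertex_boundary adj U) x by exact: AK'.
by have [[]] : ((A `&` vertex_closure adj U) `&` vertex_boundary adj U) x
  by exact: K'A.
Qed.

Lemma least_gradient_perimeter (R : realType) A :
  least_gradient adj U (\1_(A `&` vertex_closure adj U) : V -> R) ->
  least_perimeter adj U (A `&` vertex_closure adj U).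
Proof.
move=> lgA; split=> [|K' K'U K'A]; first exact: subIsetr.
rewrite (card_le_eql (card_edge_boundary _)).
rewrite (card_le_eqr (card_edge_boundary _)) card_le_II -(ler_nat R).
rewrite -!edge_variation_indic; apply: lgA => x bdx; rewrite !indicE.
have setI_bd S : (x \in S `&` vertex_boundary adj U) = (x \in S).
  by rewrite in_setI (mem_set bdx) andbT.
by rewrite -[x \in K']setI_bd K'A setI_bd.
Qed.

Lemma divergence_nbrs (Z : zmodType) (a : V -> V -> Z) x : u x ->
  \sum_(y \in nbrs adj x) a x y = divergence adj W a x.
Proof.
move=> ux; have -> : nbrs adj x = [set` [seq y <- W | adj x y]].
  apply/seteqP; split=> y /=; rewrite mem_filter; last by case/andP.
  by move=> xy; rewrite xy (nbrs_closure_seq ux xy).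
by rewrite -fsbig_seq ?filter_uniq ?closure_seq_uniq// big_filter.
Qed.

(** Calibration: [a] pairs with the gradient of the indicator to give exactly its variation, and
    with that of [g] to give at most the variation of [g]. The two pairings agree by the Green
    formula, as [g] minus the indicator vanishes on the boundary. *)
Lemma one_laplacian_least_gradient (R : realType) A :
  one_laplacian adj (\1_A : V -> R) (fun=> 0) ->
  least_gradient adj U (\1_(A `&` vertex_closure adj U) : V -> R).
Proof.
move=> [a [a_anti aS div0]] g gA; rewrite edge_variation_indic edge_variationE.
set K := A `&` _; rewrite -[leLHS](mulKf (x := 2)) ?pnatr_eq0//.
rewrite ler_pM2l ?invr_gt0// mulr_natl -(flux_indicator adj_sym _ a_anti); last first.
  move=> x y xy /= xK yK; have [xy' uxy] := andP xy.
  have yW : y \in vertex_closure adj U.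
    rewrite -mem_closure_seq; case/orP: uxy => [ux|]; last exact: sub_closure_seq.
    exact: nbrs_closure_seq xy'.
  move: xK yK; rewrite !in_setI yW andbT => /andP[xA _] yA.
  have := aS x y xy'; rewrite !indicE xA (negPf yA) subr0 /Sgn ltr01.
  by [].
have green : \sum_(x <- W) \sum_(y <- W | inner_edge adj u x y)
    a x y * ((g x - (x \in K)%:R) - (g y - (y \in K)%:R)) = 0.
  rewrite (flux adj_sym a_anti)// => [|x xW Nux].
    rewrite big1 ?mul0rn// => x ux; rewrite -divergence_nbrs//.
    by rewrite -[X in _ * X]/((fun x => \sum_(y \in nbrs adj x) a x y) x) -div0 mulr0.
  by rewrite gA ?subrr//; apply/vertex_boundaryP.
apply: (@le_trans _ _ (\sum_(x <- W) \sum_(y <- W | inner_edge adj u x y)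
    a x y * (g x - g y))).
  rewrite -subr_ge0 -sumrB -[leLHS]green le_eqVlt; apply/orP; left; apply/eqP.
  apply: eq_bigr => x _; rewrite -sumrB; apply: eq_bigr => y _.
  by rewrite -mulrBr /=; congr (_ * _); lra.
apply: ler_sum => x _; apply: ler_sum => y /andP[xy _].
rewrite (le_trans (ler_norm _))// normrM distrC ler_piMl//.
exact: Sgn_norm (aS x y xy).
Qed.

End FiniteDomain.

(* The admissible values [-1], [0], [1] being finitely many, the calibrations of
   the finite subsets of [V] converge edgewise along an ultrafilter that refines
   the inclusion order. *)
Lemma area_minimizing_one_laplacian (R : realType) A :
  area_minimizing adj A -> one_laplacian adj (\1_A : V -> R) (fun=> 0).
Proof.
move=> Amin.
have /choice[a aP] (U : {fset V}) : exists a : V -> V -> int,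
    calibrating adj (mem A) a /\
    forall x, x \in U -> divergence adj (closure_seq [set` U]) a x = 0.
  have finU : finite_set [set` U] by apply/finite_fsetP; exists U.
  have [|||a cal div0] := @divergence_free_calibration V adj adj_sym
    (closure_seq [set` U]) (mem [set` U]) (closure_seq_uniq _) _ _ (mem A).
  - exact: sub_closure_seq.
  - exact: nbrs_closure_seq.
  - exact/(least_perimeterP finU)/Amin.
  - by exists a; split=> // x xU; apply: div0; rewrite /= mem_setE.
pose above (U0 : {fset V}) : set {fset V} :=
  [set U : {fset V} | (U0 `<=` U)%fset].
have above_filter : ProperFilter (filter_from setT above).
  apply: filter_from_proper => [|U _]; last first.
    by exists U; exact: fsubset_refl.
  apply: filter_fromT_filter => [|U1 U2]; first by exists fset0.
  by exists (U1 `|` U2)%fset => U; rewrite /above /= fsubUset => /andP[].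
have [G [G_ultra aboveG]] := ultraFilterLemma above_filter.
have G_above (U : {fset V}) : G (above U) by apply: aboveG; exists U.
have /choice[b bP] (x : V) : exists b : V -> int, forall y, adj x y ->
    G [set U : {fset V} | a U x y = b y].
  suff /choice[b bP] : forall y, exists v, adj x y ->
      G [set U : {fset V} | a U x y = v] by exists b.
  move=> y.
  have [xy|_] := boolP (adj x y); last by exists 0.
  (* The ultrafilter decides each of the values 1 and 0; if it rejects both, -1 is left. *)
  have [G1|GN1] := in_ultra_setVsetC [set U : {fset V} | a U x y = 1] G_ultra.
    by exists 1.
  have [G0|GN0] := in_ultra_setVsetC [set U : {fset V} | a U x y = 0] G_ultra.
    by exists 0.
  exists (-1) => _; apply: filterS (filterI GN1 GN0) => U /= [N1 N0].
  have [[a_anti a_le1 _] _] := aP U.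
  have yx : adj y x by rewrite adj_sym.
  have := a_le1 _ _ xy; have := a_le1 _ _ yx; rewrite (a_anti y x)//; lia.
(* Each condition involves finitely many edges, so it is read off at one [U] where [a U] agrees with
   [b] on them. *)
exists (fun x y => (b x y)%:~R); split=> [x y xy|x y xy|].
- have yx : adj y x by rewrite adj_sym.
  have [U /= [<- <-]] := filter_ex (filterI (bP _ _ xy) (bP _ _ yx)).
  by have [[-> //]] := aP U; rewrite rmorphN.
- have [U /= <-] := filter_ex (bP _ _ xy).
  have [[a_anti a_le1 a1] _] := aP U.
  have yx : adj y x by rewrite adj_sym.
  rewrite !indicE /Sgn; have [xA|xA] := boolP (x \in A);
    have [yA|yA] := boolP (y \in A).
  + rewrite subrr ltxx eqxx /= in_itv /=.
    have := a_le1 _ _ xy; have := a_le1 _ _ yx; rewrite (a_anti y x)// => ? ?.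
    by rewrite -[1]/(1%:~R) -mulrNz !ler_int; lia.
  + by rewrite subr0 ltr01 /= a1.
  + by rewrite sub0r oppr_gt0 ltr10 oppr_eq0 oner_eq0 /= a_anti// a1.
  + rewrite subrr ltxx eqxx /= in_itv /=.
    have := a_le1 _ _ xy; have := a_le1 _ _ yx; rewrite (a_anti y x)// => ? ?.
    by rewrite -[1]/(1%:~R) -mulrNz !ler_int; lia.
- apply/esym/funext => x.
  have /finite_seqP[s sE] := adj_lf x.
  have adj_s y : y \in s -> adj x y.
    by move=> ys; have : nbrs adj x y by rewrite sE.
  (* Local finiteness makes agreement on all edges at [x] a finite intersection of members of
     [G]. *)
  have Gs : G [set U : {fset V} | {in s, forall y, a U x y = b x y}].
    elim: s adj_s {sE} => [|y s IH] adj_s; first exact: filterE.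
    have /IH Gs z : z \in s -> adj x z.
      by move=> zs; apply: adj_s; rewrite in_cons zs orbT.
    apply: filterS (filterI (bP x y (adj_s y (mem_head _ _))) Gs).
    by move=> U /= [yE sE] z; rewrite in_cons => /predU1P[->|/sE].
  have [U /= [abE xU]] := filter_ex (filterI Gs (G_above [fset x]%fset)).
  rewrite /above /= fsub1set in xU.
  have [_ div0] := aP U.
  have finU : finite_set [set` U] by apply/finite_fsetP; exists U.
  rewrite (eq_fsbigr (fun y => (a U x y)%:~R)); last first.
    by move=> y /set_mem; rewrite sE => /abE ->.
  rewrite (divergence_nbrs finU (fun v w => (a U v w)%:~R : R)) ?mem_setE//.
  by rewrite /divergence -rmorph_sum -/(divergence _ _ _ _) div0.
Qed.

End LocallyFiniteGraph.

Theorem theorem1p7 (R : realType) (V : choiceType) (adj : rel V)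
    (adj_sym : symmetric adj) (adj_irr : irreflexive adj)
    (adj_lf : locally_finite adj)
    (A : set V) (A_nonempty : A !=set0) (A_proper : A `<` setT) :
  (area_minimizing adj A <->
   (forall U : set V, finite_set U ->
      least_gradient adj U (\1_(A `&` vertex_closure adj U) : V -> R))) /\
  (area_minimizing adj A <->
   one_laplacian adj (\1_A : V -> R) (fun=> 0)).
Proof.
have lg_am : (forall U : set V, finite_set U ->
    least_gradient adj U (\1_(A `&` vertex_closure adj U) : V -> R)) ->
    area_minimizing adj A.
  move=> lgA U finU.
  exact: (least_gradient_perimeter adj_sym adj_irr adj_lf finU (lgA U finU)).
have lap_lg : one_laplacian adj (\1_A : V -> R) (fun=> 0) ->
    forall U : set V, finite_set U ->
    least_gradient adj U (\1_(A `&` vertex_closure adj U) : V -> R).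
  by move=> lapA U finU; exact: one_laplacian_least_gradient.
have am_lap : area_minimizing adj A ->
    one_laplacian adj (\1_A : V -> R) (fun=> 0).
  exact: area_minimizing_one_laplacian.
by (split; split=> //); [move=> /am_lap/lap_lg|move=> /lap_lg/lg_am].
Qed.
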